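(* Consider complex black-box rounded arithmetic with operations $q_{-2},q_{-1},q_0$, multiplication by complex constants $q^c(z)=c\cdot z$, and $\{q_j:j\in J\}$, where each $q_j$, $j\in J$, is an irreducible polynomial. If all black-box operations $q_j$, $j\in J$, are affine, then a polynomial $p:\mathbb C^n\to\mathbb C$ is accurately evaluable on $\mathbb C^n$ if and only if $V(p)$ is a union of intersections of hyperplanes $Z_i=\{x:x_i=0\}$, $S_{ij}=\{x:x_i+x_j=0\}$, $D_{ij}=\{x:x_i-x_j=0\}$, and varieties $V_{\mathcal I}(q_j)$, for $j\in J$ and all $\mathcal I=(T,\mathcal K_Z,\mathcal K_D,\mathcal K_S,\mathcal K_N)$.
   Context: **Black-box rounded arithmetic.** A black-box operation takes finitely many complex inputs and has as exact output a polynomial in its inputs. Here $q_{-2}(z_1,z_2)=z_1z_2$, $q_{-1}(z_1,z_2)=z_1+z_2$, $q_0(z_1,z_2)=z_1-z_2$; $J$ may be infinite; $q^c$ is available for every complex constant $c$. An algorithm receives its input $x\in\mathbb C^n$ exactly and is a finite directed acyclic graph with sources carrying the variables $x_i$, computational nodes, possibly branching nodes (exact equality tests of intermediate quantities), and one output node per branch. Each computational node applies one of the available operations to inputs that are sources or outputs of other computational nodes (possibly repeated, each possibly negated exactly) and multiplies the exact result by $(1+\delta_i)$, where $\delta_i$ is a complex error variable specific to that node, arbitrary subject to $|\delta_i|\le\epsilon$. The output is $p_{comp}(x,\delta)$; an algorithm for $p$ satisfies $p_{comp}(x,0)=p(x)$. It is accurate on $\mathcal D$ if for every $0<\eta<1$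 there is $0<\epsilon<1$ such that $|p_{comp}(x,\delta)-p(x)|\le\eta|p(x)|$ for all $x\in\mathcal D$ and all $\delta$ with $|\delta_i|\le\epsilon$ for all $i$. $p$ is accurately evaluable on $\mathcal D$ if some algorithm is accurate for $p$ on $\mathcal D$. $V(p)=\{x\in\mathbb C^n:p(x)=0\}$. **The sets $V_{\mathcal I}(q)$.** Let $q$ be a black-box polynomial in arguments $z_1,\dots,z_m$, $\mathcal K=\{1,\dots,m\}$. Choose $\mathcal K_Z\subseteq\mathcal K$ and $\mathcal K_D,\mathcal K_S\subseteq\mathcal K\times\mathcal K$. Impose $z_i=0$ for $i\in\mathcal K_Z$, $z_i-z_j=0$ for $(i,j)\in\mathcal K_D$, $z_i+z_j=0$ for $(i,j)\in\mathcal K_S$ (eliminating the second variable of each pair); let $\tilde q$ be the resulting polynomial and $\mathcal K_R$ the index set of the remaining independent variables. Choose $T\subseteq\mathcal K_R$, expand $\tilde q=\sum_\alpha q_\alpha z_T^\alpha$ with $q_\alpha$ polynomials in $z_{\mathcal K_R\setminus T}$ only, and take $\bigcap_\alpha V(q_\alpha)$. Finally choose $\mathcal K_N\subseteq\mathcal K_R\setminus T$ and negate each variable in $\mathcal K_N$ in this variety; the result is $V_{\mathcal I}(q)$. It is regarded as a subset of $\mathbb C^n$ by identifying the remaining arguments $z_i$, $i\in\mathcal K_R\setminus T$, with distinct coordinates among $x_1,\dots,x_n$, in any way.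
   Formalization: If p is a nonzero constant, it is assumed that q_j(0) ≠ 0 for some j: otherwise V(p) is empty, hence a (possibly empty) union, but every quantity computed at x = 0 is 0, so p has no algorithm. Also n ≥ 1, and unions and intersections are taken to be finite. *)

(* Defs.v *)
From HB Require Import structures.
From mathcomp Require Import all_boot all_order all_algebra.
From mathcomp Require Import classical_sets reals complex.
From mathcomp Require Import mpoly.

Set Implicit Arguments.
Unset Strict Implicit.
Unset Printing Implicit Defensive.

Import Order.TTheory GRing.Theory Num.Theory.
Local Open Scope classical_set_scope.
Local Open Scope complex_scope.
Local Open Scope ring_scope.

Definition irreducible_mpoly (F : fieldType) (m : nat) (q : {mpoly F[m]}) :=
  [/\ q != 0, q \isn't a GRing.unit &
      forall a b : {mpoly F[m]}, q = a * b ->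
        (a \is a GRing.unit) || (b \is a GRing.unit)].

(* [msize] is the total degree plus one. *)
Definition affine_mpoly (F : fieldType) (m : nat) (q : {mpoly F[m]}) :=
  (msize q <= 2)%N.

Section Algorithms.
Variables (R : realType) (J : Type) (ar : J -> nat).
Variable q : forall j : J, {mpoly R[i][ar j]}.
Implicit Types (n k : nat).

Inductive op :=
  | OpMul | OpAdd | OpSub
  | OpScale of R[i]
  | OpBox of J.

Definition op_arity (o : op) : nat :=
  match o with
  | OpMul | OpAdd | OpSub => 2
  | OpScale _ => 1
  | OpBox j => ar j
  end.

Definition op_poly (o : op) : {mpoly R[i][op_arity o]} :=
  match o return {mpoly R[i][op_arity o]} with
  | OpMul => 'X_ord0 * 'X_ord_max
  | OpAdd => 'X_ord0 + 'X_ord_max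
  | OpSub => 'X_ord0 - 'X_ord_max
  | OpScale c => c *: 'X_ord0
  | OpBox j => q j
  end.

(* A [prog k] is the rest of an algorithm once [k] quantities (the sources,
   then the computational nodes met so far, in topological order) are
   available.  An input of a computational node is a pair (b, i): the quantity
   number i, negated when b is true.  Any of the [k] quantities may be reused,
   so the nodes of a branch form a directed acyclic graph; only the branching
   is unfolded into a tree, with one output per branch. *)
Inductive prog : nat -> Type :=
  | Output k of 'I_k : prog k
  | Compute k (o : op) of ('I_(op_arity o) -> bool * 'I_k) & prog k.+1 : prog k
  | Branch k of 'I_k & 'I_k & prog k & prog k : prog k.

Fixpoint node k (P : prog k) : Type :=
  match P with
  | Output _ _ => void
  | Compute _ _ _ P' => option (node P')
  | Branch _ _ _ P1 P2 => (node P1 + node P2)%type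
  end.

Definition extend (T : Type) k (v : 'I_k -> T) (y : T) : 'I_k.+1 -> T :=
  fun i => if unlift ord_max i is Some i' then v i' else y.

Fixpoint eval k (P : prog k) :
    ('I_k -> R[i]) -> (node P -> R[i]) -> R[i] :=
  match P in prog k return ('I_k -> R[i]) -> (node P -> R[i]) -> R[i] with
  | Output _ a => fun v _ => v a
  | Compute _ o arg P' => fun v delta =>
      let exact := (op_poly o).@[fun t => (-1) ^+ (arg t).1 * v (arg t).2] in
      eval (extend v (exact * (1 + delta None))) (fun d => delta (Some d))
  | Branch _ a b P1 P2 => fun v delta =>
      if v a == v b then eval v (fun d : node P1 => delta (inl d))
      else eval v (fun d : node P2 => delta (inr d))
  end.

Definition algorithm_for n (p : {mpoly R[i][n]}) (P : prog n) :=
  forall x : 'I_n -> R[i], eval x (fun _ : node P => 0) = p.@[x].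

Definition accurate_on n (D : set ('I_n -> R[i])) (p : {mpoly R[i][n]})
    (P : prog n) :=
  forall eta : R, 0 < eta < 1 ->
  exists eps : R, 0 < eps < 1 /\
    forall (x : 'I_n -> R[i]) (delta : node P -> R[i]), D x ->
      (forall d, `|delta d| <= eps%:C) ->
      `|eval x delta - p.@[x]| <= eta%:C * `|p.@[x]|.

Definition accurately_evaluable n (D : set ('I_n -> R[i]))
    (p : {mpoly R[i][n]}) :=
  exists P : prog n, algorithm_for p P /\ accurate_on D p P.

End Algorithms.

Definition zeros (R : realType) (n : nat) (p : {mpoly R[i][n]}) :
    set ('I_n -> R[i]) :=
  [set x | p.@[x] = 0].

Section BoxVarieties.
Variables (R : realType) (m : nat).

Definition imposed (KZ : {set 'I_m}) (KD KS : {set 'I_m * 'I_m})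
    (z : 'I_m -> R[i]) :=
  [/\ forall i, i \in KZ -> z i = 0,
      forall ij, ij \in KD -> z ij.1 - z ij.2 = 0 &
      forall ij, ij \in KS -> z ij.1 + z ij.2 = 0].

(* An elimination [e] replaces z_k by 0 when [e k = None], and by (-1)^b z_r
   when [e k = Some (b, r)]. *)
Definition elim_poly (e : 'I_m -> option (bool * 'I_m)) (k : 'I_m) :
    {mpoly R[i][m]} :=
  if e k is Some (b, r) then (-1) ^+ b *: 'X_r else 0.

(* [KR] indexes the remaining independent variables and [e] expresses all the
   variables through them on the solution space of the imposed equations.
   Several [KR] are possible: which variable of a group of variables equal up
   to sign is kept (for a pair (i, j), the first one) is not prescribed, so
   that cyclic pairs such as (i, j), (j, i) need no special treatment.  This
   does not change the family of varieties obtained below, because the kept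
   variables are negated and identified with coordinates in all ways. *)
Definition elimination (KZ : {set 'I_m}) (KD KS : {set 'I_m * 'I_m})
    (KR : {set 'I_m}) (e : 'I_m -> option (bool * 'I_m)) :=
  [/\ forall r, r \in KR -> e r = Some (false, r),
      forall k b r, e k = Some (b, r) -> r \in KR &
      forall z : 'I_m -> R[i],
        imposed KZ KD KS z <-> forall k, z k = (elim_poly e k).@[z]].

Definition mnm_part (T : {set 'I_m}) (mu : 'X_{1..m}) : 'X_{1..m} :=
  [multinom if i \in T then mu i else 0%N | i < m].

(* The coefficient q_alpha of z_T^alpha in q, a polynomial in the variables
   outside T. *)
Definition coeff_in (T : {set 'I_m}) (alpha : 'X_{1..m})
    (q : {mpoly R[i][m]}) : {mpoly R[i][m]} :=
  \sum_(mu <- msupp q | mnm_part T mu == alpha)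
    q@_mu *: 'X_[mnm_part (~: T) mu].

(* [iota] identifies the arguments z_k, for k in KR \ T, with coordinates of
   C^n; its other values do not matter. *)
Definition box_variety (n : nat) (q : {mpoly R[i][m]})
    (e : 'I_m -> option (bool * 'I_m)) (T KN : {set 'I_m})
    (iota : 'I_m -> 'I_n) : set ('I_n -> R[i]) :=
  [set x | forall alpha : 'X_{1..m},
     (coeff_in T alpha (q \mPo [tuple elim_poly e k | k < m])).@[
        fun k => (-1) ^+ (k \in KN) * x (iota k)] = 0].

End BoxVarieties.

Section Pieces.
Variables (R : realType) (J : Type) (ar : J -> nat).
Variable q : forall j : J, {mpoly R[i][ar j]}.
Variable n : nat.

Inductive piece : set ('I_n -> R[i]) -> Prop :=
  | piece_Z i : piece [set x | x i = 0]
  | piece_S i j of i != j : piece [set x | x i + x j = 0]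
  | piece_D i j of i != j : piece [set x | x i - x j = 0]
  | piece_box j (KZ : {set 'I_(ar j)}) (KD KS : {set 'I_(ar j) * 'I_(ar j)})
      (KR T KN : {set 'I_(ar j)}) e (iota : 'I_(ar j) -> 'I_n) of
      elimination R KZ KD KS KR e & T \subset KR & KN \subset KR :\: T &
      {in KR :\: T &, injective iota} :
      piece (box_variety (q j) e T KN iota).

(* The union must be finite: if J is uncountable, say q_c(z) = z - c for all
   complex c, every subset of C^n is an infinite union of intersections.  The
   empty intersection is C^n, which is V(0). *)
Definition union_of_intersections (V : set ('I_n -> R[i])) :=
  exists (N : nat) (M : 'I_N -> nat)
         (B : forall a : 'I_N, 'I_(M a) -> set ('I_n -> R[i])),
    (forall a b, piece (B a b)) /\ V = \bigcup_a \bigcap_b B a b.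

End Pieces.

(* Main.v *)
Require Import Defs.
From mathcomp Require Import all_boot all_order all_algebra.
From mathcomp Require Import classical_sets reals complex.
From mathcomp Require Import mpoly.
From mathcomp Require Import boolp ring.

(** Write V for the zero set of p.

    Necessity. Run an accurate program on an input x. With relative error 1/2
    allowed, p vanishes at x if and only if the output vanishes for some
    admissible errors, and then it vanishes for all of them; so the errors may
    be taken generic. A rounded quantity e (1 + d) with e nonzero and d generic
    satisfies no algebraic relation with the quantities computed before it.
    Hence every exact equality met during the run (a branching test, the
    vanishing of a computed quantity) comes down to equalities of a special
    kind: one affine operation applied to inputs, each of which is 0 or a
    signed coordinate of x. The 0 stands for a rounded quantity, which is
    either 0 or free. A program yields only finitely many such equalities, the
    [tests] below, and [generic_errors] implies that two inputs on which the
    same tests vanish are both in V or both outside. Each test vanishes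
    everywhere or exactly on a piece ([test_zero_set]). If x is in V and y is a
    point where all the tests vanishing at x vanish, then on all but finitely
    many points of the line through x and y the same tests vanish as at x; p
    vanishes there, hence on the whole line, hence at y. So V is the union of
    those intersections of these pieces that it contains.

    Sufficiency. Every piece is empty, or the whole space, or is contained in
    the zero set of a test that is not identically zero ([piece_in_test]). If
    p is nonzero, then V is therefore covered by finitely many hyperplanes
    whose equations are tests, and [product_of_affine] shows that p is a
    constant times a product of these affine forms. Each form costs one
    rounded operation on exact inputs (0 is obtained exactly as x - x), so
    that multiplying them out gives a small relative error. A nonzero constant
    p is obtained by scaling the nonzero value at 0 of a black box. *)

Local Open Scope ring_scope.

Set Implicit Arguments.
Unset Strict Implicit.
Unset Printing Implicit Defensive.

Import Order.TTheory GRing.Theory Num.Theory.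

(** * Polynomials over an algebraically closed field *)

Lemma avoid_small (F : numFieldType) (s : seq F) (e : F) :
  0 < e -> exists2 d, `|d| <= e & d \notin s.
Proof.
move=> e_gt0; pose c i : F := e / i.+1%:R.
have c_inj : injective c.
  move=> i j /(mulfI (lt0r_neq0 e_gt0)) /invr_inj /eqP.
  by rewrite eqr_nat eqSS => /eqP.
have [|/allPn[i _ cs]] := boolP (all (fun i => c i \in s) (iota 0 (size s).+1)).
  move=> /allP cs; have : uniq (map c (iota 0 (size s).+1)).
    by rewrite map_inj_uniq // iota_uniq.
  move/uniq_leq_size => /(_ s); rewrite size_map size_iota ltnn => H.
  have /H // : {subset map c (iota 0 (size s).+1) <= s}.
  by move=> _ /mapP[i /cs ci ->].
exists (c i) => //.
rewrite ger0_norm; last by rewrite divr_ge0 ?ler0n ?ltW.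
rewrite ler_pdivrMr ?ltr0n //.
by rewrite ler_peMr ?ler1n // ltW.
Qed.

Lemma notin_map_all (T : Type) (S : eqType) (f : T -> S) (d : S) (s : seq T) :
  d \notin map f s -> all (fun t => f t != d) s.
Proof.
by elim: s => //= t s IHs; rewrite inE negb_or eq_sym => /andP[-> /IHs].
Qed.

Lemma poly_eq0_outside (F : numClosedFieldType) (g : {poly F}) (bad : seq F) :
  (forall s, s \notin bad -> g.[s] = 0) -> g = 0.
Proof.
move=> g0; have [rs def_g] := closed_field_poly_normal g.
have [s _] := avoid_small (bad ++ rs) ltr01.
rewrite mem_cat negb_or => /andP[/g0 gs0 s_rs].
apply/eqP; apply: contraR s_rs => g_neq0; move: gs0.
rewrite {1}def_g hornerZ => /eqP; rewrite mulf_eq0 lead_coef_eq0 (negPf g_neq0).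
by rewrite /= -/(root _ _) root_prod_XsubC.
Qed.

Lemma digits_inj B n (f g : 'I_n -> nat) :
  (forall i, f i < B)%N -> (forall i, g i < B)%N ->
  (\sum_(i < n) f i * B ^ i = \sum_(i < n) g i * B ^ i)%N -> f =1 g.
Proof.
elim: n f g => [|n IHn] f g fB gB; first by move=> _ [].
have shift (h : 'I_n.+1 -> nat) : (\sum_(i < n.+1) h i * B ^ i =
    (\sum_(i < n) h (lift ord0 i) * B ^ i) * B + h ord0)%N.
  rewrite big_ord_recl muln1 addnC big_distrl /=; congr addn.
  by apply: eq_bigr => i _; rewrite -mulnA -expnSr.
rewrite !shift => eq_fg.
have eq0 : f ord0 = g ord0.
  by have := congr1 (modn^~ B) eq_fg; rewrite !modnMDl !modn_small.
have B_gt0 : (0 < B)%N by apply: leq_ltn_trans (fB ord0).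
move: eq_fg; rewrite eq0 => /addIn /eqP; rewrite eqn_pmul2r // => /eqP.
move=> /IHn eq_lift i; case: (unliftP ord0 i) => [j|] -> //.
by apply: eq_lift => k; [apply: fB | apply: gB].
Qed.

(** Kronecker substitution: on the curve x_i = t ^ (B ^ i), with B larger than
    all exponents, distinct monomials become distinct powers of t. *)
Lemma mpoly_nonzero_value (F : numClosedFieldType) n (p : {mpoly F[n]}) :
  p != 0 -> exists x, p.@[x] != 0.
Proof.
move=> p_neq0; pose B := msize p.
pose kappa (m : 'X_{1..n}) := (\sum_(i < n) m i * B ^ i)%N.
have digit m : m \in msupp p -> forall i : 'I_n, (m i < B)%N.
  move=> /msize_mdeg_lt m_lt i; apply: leq_ltn_trans m_lt.
  by rewrite mdegE (bigD1 i) //= leq_addr.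
pose g : {poly F} := \sum_(m <- msupp p) p@_m *: 'X^(kappa m).
have g_neq0 : g != 0.
  have m0p : mlead p \in msupp p by rewrite mlead_supp.
  move: (mlead p) m0p => m0 m0p; apply/eqP => g0.
  have /= := congr1 (fun h : {poly F} => h`_(kappa m0)) g0.
  rewrite coef0 /g coef_sum (bigD1_seq m0) ?msupp_uniq //=.
  rewrite coefZ coefXn eqxx mulr1.
  rewrite big_seq_cond big1 ?addr0 => [/eqP|m /andP[mp m_m0]].
    by rewrite mcoeff_eq0 m0p.
  rewrite coefZ coefXn; case: eqP => [eqk|]; last by rewrite mulr0.
  case/eqP: m_m0; apply/mnmP; apply: (@digits_inj B); first exact: digit.
    exact: digit.
  by rewrite -/(kappa m) -/(kappa m0).
have [t gt] : exists t, g.[t] != 0.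
  apply: contrapT => /forallNP t0; case/eqP: g_neq0; apply: (@poly_eq0_outside _ _ [::]).
  by move=> s _; apply/eqP; apply: contraT => /t0.
exists (fun i => t ^+ (B ^ i)); apply: contraNneq gt => p0; apply/eqP.
rewrite -[RHS]p0 mevalE horner_sum; apply: eq_bigr => m _.
rewrite hornerZ hornerXn; congr (_ * _); rewrite /kappa -prodrXr.
by apply: eq_bigr => i _; rewrite -exprM mulnC.
Qed.

Lemma meval_line (F : comNzRingType) n (p : {mpoly F[n]}) (x u : 'I_n -> F) :
  exists g : {poly F}, forall s, g.[s] = p.@[fun i => x i + s * u i].
Proof.
exists (\sum_(m <- msupp p) p@_m *: \prod_i ((x i)%:P + u i *: 'X) ^+ m i) => s.
rewrite mevalE horner_sum; apply: eq_bigr => m _; rewrite hornerZ horner_prod.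
by congr (_ * _); apply: eq_bigr => i _; rewrite !hornerE [s * _]mulrC.
Qed.

Lemma comp_mpoly_congr (F : comNzRingType) n k (l : {mpoly F[k]})
    (s t : n.-tuple {mpoly F[k]}) (p : {mpoly F[n]}) :
  (forall i, exists b, tnth s i - tnth t i = l * b) ->
  exists b, (p \mPo s) - (p \mPo t) = l * b.
Proof.
move=> st; pose cong a b := exists c, a - b = l * c.
have congM a b a' b' : cong a a' -> cong b b' -> cong (a * b) (a' * b').
  move=> [c ac] [d bd]; exists (c * b + a' * d).
  have /eqP := ac; rewrite subr_eq => /eqP ->.
  have /eqP := bd; rewrite subr_eq => /eqP ->; ring.
have congX a b i : cong a b -> cong (a ^+ i) (b ^+ i).
  move=> ab; elim: i => [|i IHi]; last by rewrite !exprS; apply: congM.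
  by exists 0; rewrite subrr mulr0.
elim/mpolyind: p => [|c m p _ _ [b pb]].
  by exists 0; rewrite !comp_mpoly0 subrr mulr0.
have [d md] : cong ('X_[m] \mPo s) ('X_[m] \mPo t).
  rewrite !comp_mpolyX; apply: (big_ind2 cong) => [||i _].
    - by exists 0; rewrite subrr mulr0.
    - by move=> *; apply: congM.
  exact/congX/st.
exists (c *: d + b); rewrite !comp_mpolyD !comp_mpolyZ mulrDr -pb -scalerAr -md.
by rewrite scalerBr; ring.
Qed.

(** If p is not constant, it is enough to find a form l a that divides p, and
    then to induct on the degree. For a direction u along which l a is not
    constant, let proj a be the projection along u onto the hyperplane l a = 0.
    It is the identity modulo l a, so l a divides p as soon as p composed with
    proj a is 0. If this composition were nonzero for all a, a generic line
    with direction u would meet no hyperplane at a zero of p; but p has a zero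
    on that line, and this zero must lie on some hyperplane. *)
Lemma product_of_affine (F : numClosedFieldType) n (I : finType)
    (l : I -> {mpoly F[n]}) (p : {mpoly F[n]}) :
  (forall a x u s, (l a).@[fun i => x i + s * u i] =
      (l a).@[x] + s * ((l a).@[u] - (l a).@[fun=> 0])) ->
  (forall a, exists x y, (l a).@[x] != (l a).@[y]) ->
  p != 0 -> (forall x, p.@[x] = 0 -> exists a, (l a).@[x] = 0) ->
  exists c (s : seq I), p = c%:MP * \prod_(a <- s) l a.
Proof.
move=> l_affine l_nonconst; have [d] := ubnP (msize p).
elim: d p => // d IHd p p_d p_neq0 p_l.
have [p_le1|p_gt1] := leqP (msize p) 1.
  by exists p@_0, [::]; rewrite big_nil mulr1 -msize1_polyC.
suff [a [b def_p]] : exists a b, p = l a * b.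
  have : p != 0 by []; rewrite {1}def_p mulf_eq0 negb_or => /andP[la0 b0].
  have la_size : (1 < msize (l a))%N.
    rewrite ltnNge; apply/negP => /msize1_polyC la.
    by have [x [y]] := l_nonconst a; rewrite la !mevalC eqxx.
  have [|//|x bx|c [s def_b]] := IHd b.
  - move: p_d; rewrite def_p msizeM // ltnS; apply: leq_trans.
    by case: (msize (l a)) la_size => [|[|k]] // _; rewrite !addSn ltnS leq_addl.
  - by apply: p_l; rewrite def_p mevalM bx mulr0.
  exists c, (a :: s); rewrite big_cons def_p def_b; ring.
(* A direction along which no form is constant; that p differs at u and at 0
   makes p non-constant on a generic line with this direction. *)
have [u] : exists u, ((p - (p.@[fun=> 0])%:MP) *
    \prod_a (l a - ((l a).@[fun=> 0])%:MP)).@[u] != 0.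
  apply: mpoly_nonzero_value; rewrite mulf_neq0 //.
    apply: contraTneq p_gt1 => /eqP; rewrite subr_eq0 => /eqP ->.
    by rewrite msizeC -leqNgt; case: (_ != _).
  apply/prodf_neq0 => a _; have [x [y]] := l_nonconst a.
  apply: contraNneq => /eqP; rewrite subr_eq0 => /eqP ->.
  by rewrite !mevalC.
rewrite mevalM mulf_eq0 negb_or mevalB mevalC rmorph_prod.
move=> /andP[pu /prodf_neq0 lu].
have {}lu a : (l a).@[u] - (l a).@[fun=> 0] != 0.
  by have /= := lu a isT; rewrite mevalB mevalC.
pose proj a :=
  [tuple 'X_i - (u i / ((l a).@[u] - (l a).@[fun=> 0])) *: l a | i < n].
have [/existsP[a /eqP pa]|] := boolP [exists a, p \mPo proj a == 0].
  exists a.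
  have [|b] := @comp_mpoly_congr _ _ _ (l a) [tuple 'X_i | i < n] (proj a) p.
    move=> i; exists ((u i / ((l a).@[u] - (l a).@[fun=> 0]))%:MP).
    by rewrite !tnth_mktuple opprB addrCA subrr addr0 -mul_mpolyC; apply: mulrC.
  by rewrite comp_mpoly_id pa subr0 => ->; exists b.
rewrite negb_exists => /forallP p_proj; exfalso.
pose shift := [tuple 'X_i + (u i)%:MP | i < n].
have [x] : exists x, (((p \mPo shift) - p) * \prod_a (p \mPo proj a)).@[x] != 0.
  apply: mpoly_nonzero_value; rewrite mulf_neq0 //; last by apply/prodf_neq0.
  apply: contraNneq pu => /(congr1 (meval (fun=> 0))) /eqP.
  rewrite meval0 mevalB comp_mpoly_meval; congr (_ - _ == _).
  by apply: meval_eq => i; rewrite tnth_mktuple mevalD mevalXU mevalC add0r.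
rewrite mevalM mulf_eq0 negb_or mevalB rmorph_prod.
move=> /andP[px /prodf_neq0 projx].
have [g gE] := meval_line p x u.
have /closed_rootP[t] : size g != 1%N.
  apply: contraNneq px => /eqP/size_poly1P[c _ def_g].
  have -> : (p \mPo shift).@[x] = g.[1].
    rewrite gE comp_mpoly_meval; apply: meval_eq => i.
    by rewrite tnth_mktuple mevalD mevalXU mevalC mul1r.
  have -> : p.@[x] = g.[0].
    by rewrite gE; apply: meval_eq => i; rewrite mul0r addr0.
  by rewrite def_g !hornerC subrr.
rewrite /root gE => /eqP pt; have [a] := p_l _ pt.
rewrite l_affine => /eqP; rewrite addr_eq0 => /eqP lax.
case/eqP: (projx a isT); rewrite /= comp_mpoly_meval -[RHS]pt.
apply: meval_eq => i; rewrite tnth_mktuple mevalB mevalXU mevalZ lax.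
by rewrite mulrN opprK mulrA mulrAC divfK // [u i * t]mulrC.
Qed.

(** * Affine polynomials and affine functions *)

Lemma affine_mpolyE (F : fieldType) m (f : {mpoly F[m]}) :
  affine_mpoly f -> f = (f@_0%MM)%:MP + \sum_i f@_U_(i) *: 'X_i.
Proof.
move=> f_affine; apply/mpolyP => mu; rewrite mcoeffD mcoeffC raddf_sum /=.
have U0 i : U_(i)%MM <> 0%MM :> 'X_{1..m}.
  by move=> /(congr1 (@mdeg _)); rewrite mdeg1 mdeg0.
have [mu_eq0|] := posnP (mdeg mu).
  have -> : mu = 0%MM by apply/eqP; rewrite -mdeg_eq0 mu_eq0.
  rewrite eqxx mulr1 big1 ?addr0 // => i _.
  by rewrite mcoeffZ mcoeffX; case: eqP => [e0|_]; rewrite ?mulr0 //; have := U0 _ e0.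
rewrite leq_eqVlt eq_sym => /predU1P[/eqP/mdeg1P[i /eqP ->]|mu_gt1].
  case: eqP => [e0|_]; first by have := U0 _ e0.
  rewrite mulr0 add0r (bigD1 i) //= big1 => [|j j_i].
    by rewrite mcoeffZ mcoeffX eqxx mulr1 addr0.
  rewrite mcoeffZ mcoeffX; case: eqP => [/eqP|]; last by rewrite mulr0.
  by rewrite eq_mnm1 (negPf j_i).
rewrite memN_msupp_eq0; last by rewrite msize_mdeg_ge // (leq_trans f_affine).
case: eqP mu_gt1 => [->|_ mu_gt1]; first by rewrite mdeg0.
rewrite mulr0 big1 ?addr0 // => i _.
rewrite mcoeffZ mcoeffX; case: eqP mu_gt1 => [<-|]; last by rewrite mulr0.
by rewrite mdeg1.
Qed.

Definition affine_fun (F : pzRingType) m (f : ('I_m -> F) -> F) :=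
  forall x u s, f (fun i => x i + s * u i) = f x + s * (f u - f (fun=> 0)).

Lemma affine_meval (F : fieldType) m (f : {mpoly F[m]}) :
  affine_mpoly f -> affine_fun (fun x => f.@[x]).
Proof.
move=> /affine_mpolyE -> x u s /=.
have ev z : ((f@_0%MM)%:MP + \sum_i f@_U_(i) *: 'X_i).@[z] =
    f@_0%MM + \sum_i f@_U_(i) * z i.
  rewrite mevalD mevalC rmorph_sum /=; congr (_ + _).
  by apply: eq_bigr => i _; rewrite mevalZ mevalXU.
have e0 : \sum_i f@_U_(i) * 0 = 0 by rewrite big1 // => i _; rewrite mulr0.
rewrite !ev e0 addr0 [_ + _ - _]addrC addKr -addrA mulr_sumr -big_split; congr (_ + _).
by apply: eq_bigr => i _ /=; ring.
Qed.

(** * Tests, and generic executions of a program *)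

Section Tests.
Variables (R : realType) (J : Type) (ar : J -> nat).
Variable q : forall j : J, {mpoly R[i][ar j]}.
Hypothesis q_affine : forall j, affine_mpoly (q j).
Local Notation op := (op R J).
Local Notation prog := (prog R ar).
Local Notation arity := (@op_arity R J ar).
Local Notation opoly := (op_poly q).

Definition argval k (v : 'I_k -> R[i]) (a : option (bool * 'I_k)) : R[i] :=
  if a is Some (b, i) then (-1) ^+ b * v i else 0.

(** A test is an exact equation between k available quantities: the operation
    [test_op] takes the value 0 on inputs that are 0 ([None]) or signed
    quantities. *)
Record test k := Test {
  test_op : op;
  test_arg : 'I_(arity test_op) -> option (bool * 'I_k)
}.
Arguments test_arg {k} t _.

Definition test_val k (t : test k) (v : 'I_k -> R[i]) : R[i] :=
  (opoly (test_op t)).@[fun i => argval v (test_arg t i)].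

Definition affine_op (o : op) := if o is OpMul then false else true.

Lemma affine_opP (o : op) : affine_op o -> affine_fun (fun z => (opoly o).@[z]).
Proof.
case: o => [|||c|j] //= _; try exact: affine_meval; move=> x u s /=.
- by rewrite !mevalD !mevalXU; ring.
- by rewrite !mevalB !mevalXU; ring.
- by rewrite !mevalZ !mevalXU; ring.
Qed.

Lemma test_affine k (t : test k) : affine_op (test_op t) ->
  affine_fun (test_val t).
Proof.
move=> /affine_opP t_affine x u s; rewrite /test_val.
have -> : (opoly (test_op t)).@[fun i => argval (fun=> 0) (test_arg t i)] =
          (opoly (test_op t)).@[fun=> 0].
  by apply: meval_eq => i; case: (test_arg t i) => [[b j]|] //=; rewrite mulr0.
rewrite -t_affine; apply: meval_eq => i.
by case: (test_arg t i) => [[b j]|] /=; [ring | rewrite mulr0 addr0].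
Qed.

Definition drop_arg k (a : option (bool * 'I_k.+1)) : option (bool * 'I_k) :=
  if a is Some (b, i) then omap (pair b) (unlift ord_max i) else None.

Definition drop_test k (t : test k.+1) : test k :=
  Test (fun i => drop_arg (test_arg t i)).

(** The coefficient of the newest quantity in an affine test. *)
Definition slope k (t : test k.+1) : R[i] :=
  test_val t (fun i => (i == ord_max)%:R) - test_val t (fun=> 0).

Lemma test_val_extend k (t : test k.+1) v y : affine_op (test_op t) ->
  test_val t (extend v y) = test_val (drop_test t) v + y * slope t.
Proof.
move=> t_affine; have -> : test_val (drop_test t) v = test_val t (extend v 0).
  apply: meval_eq => i /=; case: (test_arg t i) => [[b j]|] //=.
  by rewrite /extend; case: unlift => //=; rewrite mulr0.
rewrite -test_affine //; apply: meval_eq => i.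
case: (test_arg t i) => [[b j]|] //=; congr (_ * _); rewrite /extend.
case: unliftP => [l ->|->]; last by rewrite eqxx add0r mulr1.
by rewrite eq_sym (negPf (neq_lift _ _)) mulr0 addr0.
Qed.

Definition var_test k (i : 'I_k) : test k :=
  @Test k (OpScale J 1) (fun=> Some (false, i)).

Definition diff_test k (i j : 'I_k) : test k :=
  @Test k (OpSub R J) (fun a => Some (false, if a == ord0 then i else j)).

Lemma var_testE k (i : 'I_k) v : test_val (var_test i) v = v i.
Proof. by rewrite /test_val /= mevalZ mevalXU expr0 !mul1r. Qed.

Lemma diff_testE k (i j : 'I_k) v : test_val (diff_test i j) v = v i - v j.
Proof. by rewrite /test_val /= mevalB !mevalXU /= expr0 !mul1r. Qed.

Definition node_tests k (o : op) :
    ('I_(arity o) -> bool * 'I_k) -> seq (test k) :=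
  match o with
  | OpMul => fun arg => [:: var_test (arg ord0).2; var_test (arg ord_max).2]
  | o => fun arg => [:: @Test k o (fun i => Some (arg i))]
  end.

(** The equations on the first k quantities that decide the course and the
    vanishing of a generic run. For a new node these are the equations saying
    that its exact value is 0, and the later equations with the new quantity
    replaced by 0: the new quantity is 0, or else a generic error prevents it
    from satisfying any equation in which it really occurs. *)
Fixpoint tests k (P : prog k) : seq (test k) :=
  match P with
  | Output _ i => [:: var_test i]
  | Compute _ o arg P' => node_tests arg ++ map (@drop_test _) (tests P')
  | Branch _ i j P1 P2 => diff_test i j :: tests P1 ++ tests P2
  end.

Lemma tests_affine k (P : prog k) :
  all (fun t => affine_op (test_op t)) (tests P).
Proof.
elim: P => // [{}k o arg P IHP|{}k i j P1 IH1 P2 IH2] /=.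
  by rewrite all_cat all_map IHP andbT; case: o arg.
by rewrite all_cat IH1 IH2.
Qed.

Definition same_zero k (v w : 'I_k -> R[i]) (t : test k) :=
  (test_val t v == 0) == (test_val t w == 0).

Lemma node_testsP k (o : op) (arg : 'I_(arity o) -> bool * 'I_k) v w :
  all (same_zero v w) (node_tests arg) ->
  ((opoly o).@[fun i => (-1) ^+ (arg i).1 * v (arg i).2] == 0) =
  ((opoly o).@[fun i => (-1) ^+ (arg i).1 * w (arg i).2] == 0).
Proof.
have testE (o' : op) (arg' : 'I_(arity o') -> bool * 'I_k) u :
    test_val (@Test k o' (fun i => Some (arg' i))) u =
    (opoly o').@[fun i => (-1) ^+ (arg' i).1 * u (arg' i).2].
  by apply: meval_eq => i /=; case: (arg' i).
case: o arg => [arg|arg|arg|c arg|j arg] /=; rewrite /same_zero /=.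
2-5: by rewrite !testE andbT => /eqP.
rewrite !var_testE andbT => /andP[/eqP e0 /eqP e1].
by rewrite !mevalM !mevalXU !mulf_eq0 e0 e1 !signr_eq0.
Qed.

(** The errors are chosen node by node, outside the finitely many values for
    which the new quantity, if it is nonzero in v or in w, satisfies by
    accident a later test in which it has a nonzero coefficient. The two runs
    then keep the same vanishing tests, so they take the same branches. *)
Lemma generic_errors k (P : prog k) (e : R[i]) v w :
  0 < e -> all (same_zero v w) (tests P) ->
  exists2 delta : node P -> R[i], forall d, `|delta d| <= e &
    (eval q v delta == 0) = (eval q w delta == 0).
Proof.
move=> e_gt0; elim: P v w => [{}k i|{}k o arg P IHP|{}k i j P1 IH1 P2 IH2] v w /=.
- rewrite /same_zero !var_testE andbT => /eqP vw.
  by exists (of_void _) => // [[]].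
- rewrite all_cat => /andP[/node_testsP].
  set ev := (_.@[_]); set ew := (_.@[fun i => _ * w _]) => evw same_drop.
  (* The error d for which y (1 + d) makes the test t vanish. *)
  pose bad (u : 'I_k -> R[i]) (y : R[i]) (t : test k.+1) :=
    - (test_val (drop_test t) u / (y * slope t)) - 1.
  have [d d_le] :=
    avoid_small (map (bad v ev) (tests P) ++ map (bad w ew) (tests P)) e_gt0.
  rewrite mem_cat negb_or => /andP[bad_v bad_w].
  have [|delta delta_le eq_eval] :=
    IHP (extend v (ev * (1 + d))) (extend w (ew * (1 + d))).
    have bad_neq0 (u : 'I_k -> R[i]) (y : R[i]) (t : test k.+1) :
        y != 0 -> slope t != 0 -> bad u y t != d ->
        test_val (drop_test t) u + y * (1 + d) * slope t != 0.
      move=> y_neq0 t_neq0; apply: contraNneq => ud0; rewrite /bad.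
      have -> : test_val (drop_test t) u = - (y * slope t * (1 + d)).
        by apply/eqP; rewrite -addr_eq0 mulrAC ud0.
      by rewrite mulNr opprK mulrC mulKf ?mulf_neq0 // addrC addKr.
    have : all (predI (predI (fun t => affine_op (test_op t))
        (preim (@drop_test k) (same_zero v w)))
        (predI (fun t => bad v ev t != d) (fun t => bad w ew t != d))) (tests P).
      rewrite !all_predI tests_affine (notin_map_all bad_v) (notin_map_all bad_w).
      by rewrite -all_map andbT same_drop.
    apply: sub_all => t /andP[/andP[/= t_affine /eqP same_t] /andP[t_v t_w]].
    rewrite /same_zero !test_val_extend //.
    have [ev0|ev_neq0] := eqVneq ev 0.
      have /eqP ew0 : ew == 0 by rewrite -evw ev0 eqxx.
      by rewrite ev0 ew0 !mul0r !addr0 same_t.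
    have ew_neq0 : ew != 0 by rewrite -evw.
    have [st|st] := eqVneq (slope t) 0; first by rewrite st !mulr0 !addr0 same_t.
    by rewrite !(negPf (bad_neq0 _ _ _ _ _ _)).
  exists (fun o => if o is Some x then delta x else d) => [[x|]|] //.
- move=> /andP[]; rewrite /same_zero !diff_testE !subr_eq0 all_cat => /eqP vw.
  rewrite -vw => /andP[/IH1[d1 d1_le e1] /IH2[d2 d2_le e2]].
  case: (v i == v j).
    exists (fun d => match d with inl d => d1 d | inr _ => 0 end) => // [[]] //.
    by rewrite normr0 ltW.
  exists (fun d => match d with inl _ => 0 | inr d => d2 d end) => // [[]] //.
  by rewrite normr0 ltW.
Qed.

End Tests.

Arguments test_arg {R J ar k} t _.

(** * Coefficients of a partially expanded polynomial *)

Lemma coeff_in0 (R : realType) m (T : {set 'I_m}) (f : {mpoly R[i][m]}) z :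
  (coeff_in T 0%MM f).@[z] = f.@[fun k => if k \in T then 0 else z k].
Proof.
rewrite /coeff_in rmorph_sum mevalE big_mkcond /=; apply: eq_bigr => mu _.
case: eqP => [/mnmP mu0|mu0].
  rewrite mevalZ mevalX; congr (_ * _); apply: eq_bigr => i _.
  have := mu0 i; rewrite !mnmE inE.
  by case: (i \in T) => //= ->; rewrite !expr0.
have [i [iT mu_i]] : exists i, i \in T /\ mu i != 0%N.
  apply: contrapT => /forallNP noi; apply: mu0; apply/mnmP => i.
  rewrite !mnmE; case: ifP => // iT; apply: contrapT => /eqP mu_i.
  by apply: (noi i).
by rewrite (bigD1 i) //= iT expr0n (negPf mu_i) mul0r mulr0.
Qed.

Lemma coeff_in_set0 (R : realType) m (alpha : 'X_{1..m})
    (f : {mpoly R[i][m]}) :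
  alpha != 0%MM -> coeff_in finset.set0 alpha f = 0.
Proof.
move=> /eqP alpha_neq0; rewrite /coeff_in big1 // => mu /eqP mu_alpha.
by case: alpha_neq0; rewrite -mu_alpha; apply/mnmP => i; rewrite !mnmE inE.
Qed.

(** In an affine polynomial, a monomial that involves z_T involves no other
    variable. *)
Lemma coeff_in_const (R : realType) m (T : {set 'I_m}) alpha (f : {mpoly R[i][m]}) z z' :
  affine_mpoly f -> alpha != 0%MM ->
  (coeff_in T alpha f).@[z] = (coeff_in T alpha f).@[z'].
Proof.
move=> f_affine /eqP alpha_neq0; rewrite /coeff_in !rmorph_sum /=.
rewrite big_seq_cond [RHS]big_seq_cond.
apply: eq_bigr => mu /andP[mu_f /eqP mu_alpha].
rewrite !mevalZ; suff -> : mnm_part (~: T) mu = 0%MM by rewrite mpolyX0 !meval1.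
have split_mu : mu = (mnm_part T mu + mnm_part (~: T) mu)%MM.
  by apply/mnmP => i; rewrite !mnmE inE; case: (i \in T); rewrite ?addn0.
have mdeg_mu : mdeg mu = (mdeg alpha + mdeg (mnm_part (~: T) mu))%N.
  by rewrite {1}split_mu mdegD mu_alpha.
have := leq_trans (msize_mdeg_lt mu_f) f_affine; rewrite mdeg_mu => lt2.
apply/eqP; rewrite -mdeg_eq0.
have : mdeg alpha != 0%N by rewrite mdeg_eq0; apply/eqP.
move: lt2; case: (mdeg alpha) => [|a] //; case: (mdeg _) => [|b] //.
by rewrite addSn addnS.
Qed.

Lemma elim_affine (R : realType) m
    (f : {mpoly R[i][m]}) (e : 'I_m -> option (bool * 'I_m)) :
  affine_mpoly f -> affine_mpoly (f \mPo [tuple elim_poly R e k | k < m]).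
Proof.
move=> /affine_mpolyE ->; rewrite comp_mpolyD comp_mpolyC raddf_sum /=.
rewrite /affine_mpoly msizeE; apply/bigmax_leqP_seq => mu mu_supp _.
rewrite ltnS leqNgt; apply/negP => mu_gt1; move: mu_supp.
rewrite mcoeff_msupp mcoeffD mcoeffC raddf_sum /=.
case: (mu =P 0%MM) mu_gt1 => [->|_ mu_gt1]; first by rewrite mdeg0.
rewrite mulr0 add0r big1 ?eqxx // => i _.
rewrite comp_mpolyZ comp_mpolyXU -tnth_nth tnth_mktuple mcoeffZ /elim_poly.
case: (e i) => [[b r]|]; last by rewrite mcoeff0 mulr0.
rewrite mcoeffZ mcoeffX; case: eqP mu_gt1 => [<-|]; first by rewrite mdeg1.
by rewrite !mulr0.
Qed.

(** * Pieces and zero sets of tests *)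

Section Pieces.
Variables (R : realType) (J : Type) (ar : J -> nat).
Variable q : forall j : J, {mpoly R[i][ar j]}.
Hypothesis q_affine : forall j, affine_mpoly (q j).
Local Notation piece := (piece q).

(** For a black-box piece, the test is the coefficient of the monomial 1 in
    the variables z_T. The other coefficients are constants, so if this one
    vanishes identically, then the piece is empty or the whole space. *)
Lemma piece_in_test n B : piece B ->
  exists t : test R ar n, [/\ affine_op (test_op t),
    forall x, B x -> test_val q t x = 0 &
    (forall x, test_val q t x = 0) -> forall x y, B x -> B y].
Proof.
have testE (o : op R J) arg x : test_val q (@Test _ _ ar n o arg) x =
    (op_poly q o).@[fun i => argval x (arg i)] by [].
have full (C : set ('I_n -> R[i])) (t : test R ar n) :
    (forall x, C x <-> test_val q t x = 0) ->
    (forall x, test_val q t x = 0) -> forall x y, C x -> C y.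
  by move=> Ct t0 x y _; apply/Ct.
case=> [i|i j _|i j _|j KZ KD KS KR T KN e iota _ _ _ _].
- exists (@var_test R J ar n i).
  have tE x : x i = 0 <-> test_val q (@var_test R J ar n i) x = 0 by rewrite var_testE.
  by split => //; [move=> x /tE | apply: full].
- pose t := @Test R _ ar _ (OpAdd R J)
    (fun a => Some (false, if a == ord0 then i else j)).
  have tE x : x i + x j = 0 <-> test_val q t x = 0.
    by rewrite /test_val /= mevalD !mevalXU /= expr0 !mul1r.
  by exists t; split => //; [move=> x /tE | apply: full].
- have tE x : x i - x j = 0 <-> test_val q (@diff_test R J ar n i j) x = 0.
    by rewrite diff_testE.
  by exists (@diff_test R J ar n i j); split => //; [move=> x /tE | apply: full].
- pose arg k := if e k is Some (b, r) then
    if r \in T then None else Some (b (+) (r \in KN), iota r) else None.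
  pose t := @Test R _ ar _ (OpBox R j) arg.
  pose Q := q j \mPo [tuple elim_poly R e k | k < ar j].
  have tE x : (coeff_in T 0%MM Q).@[
      fun k => (-1) ^+ (k \in KN) * x (iota k)] = test_val q t x.
    rewrite coeff_in0 comp_mpoly_meval; apply: meval_eq => k.
    rewrite tnth_mktuple /elim_poly /t /= /arg; case: (e k) => [[b r]|] /=.
      rewrite mevalZ mevalXU; case: (r \in T); rewrite ?mulr0 //=.
      by rewrite mulrA signr_addb.
    by rewrite meval0.
  exists t; split=> // [x Bx|t0 x y Bx alpha]; first by rewrite -tE.
  have [->|alpha_neq0] := eqVneq alpha 0%MM; first by rewrite tE.
  pose z k := (-1) ^+ (k \in KN) * x (iota k).
  by rewrite (coeff_in_const _ _ z) ?elim_affine //; apply: Bx.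
Qed.

Lemma two_args_zero_set n (a a' : option (bool * 'I_n)) :
  (forall x : 'I_n -> R[i], argval x a + argval x a' = 0) \/
  piece [set x | argval x a + argval x a' = 0]%classic.
Proof.
have pieceZ b i : piece [set x : 'I_n -> R[i] | (-1) ^+ b * x i = 0]%classic.
  suff -> : [set x : 'I_n -> R[i] | (-1) ^+ b * x i = 0]%classic =
    [set x | x i = 0]%classic by apply: piece_Z.
  apply/seteqP; split=> x /= /eqP.
    by rewrite mulf_eq0 signr_eq0 => /eqP.
  by move=> /eqP ->; rewrite mulr0.
case: a a' => [[b i]|] [[b' j]|] /=.
- have [<-|i_j] := eqVneq i j.
    have [->|b_b'] := eqVneq b' (~~ b).
      by left=> x; rewrite signrN mulNr subrr.
    right; have -> : b' = b by case: b b' b_b' => [] [].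
    rewrite [X in piece X](_ : _ = [set x | (-1) ^+ b * x i = 0]%classic) //.
    apply/seteqP; split=> x /= /eqP; last by move=> /eqP ->; rewrite addr0.
    by rewrite -mulr2n mulrn_eq0 => /eqP.
  right; have [->|b_b'] := eqVneq b' b.
    rewrite [X in piece X](_ : _ = [set x | x i + x j = 0]%classic).
      exact: piece_S.
    apply/seteqP; split=> x /= /eqP; rewrite -mulrDr.
      by rewrite mulf_eq0 signr_eq0 => /eqP.
    by move=> /eqP ->; rewrite mulr0.
  have -> : b' = ~~ b by case: b b' b_b' => [] [].
  rewrite [X in piece X](_ : _ = [set x | x i - x j = 0]%classic).
    exact: piece_D.
  apply/seteqP; split=> x /= /eqP; rewrite signrN mulNr -mulrBr.
    by rewrite mulf_eq0 signr_eq0 => /eqP.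
  by move=> /eqP ->; rewrite mulr0.
- right; rewrite [X in piece X](_ : _ = [set x | (-1) ^+ b * x i = 0]%classic) //.
  by apply/seteqP; split=> x /=; rewrite addr0.
- right; rewrite [X in piece X](_ : _ = [set x | (-1) ^+ b' * x j = 0]%classic) //.
  by apply/seteqP; split=> x /=; rewrite add0r.
by left=> x; rewrite addr0.
Qed.

(** The equation of a black box on inputs that are 0 or signed coordinates is
    a piece without expansion variables (T empty): K_Z collects the inputs 0,
    K_D and K_S the pairs of inputs that are equal or opposite because they
    use the same coordinate, and one input per coordinate remains. *)
Lemma box_zero_set n (i0 : 'I_n) j (arg : 'I_(ar j) -> option (bool * 'I_n)) :
  piece [set x | (q j).@[fun k => argval x (arg k)] = 0]%classic.
Proof.
(* The argument that is kept for the coordinate i. *)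
pose rep i := [pick k | omap snd (arg k) == Some i].
pose neg r := if arg r is Some (b, _) then b else false.
have repP k b i : arg k = Some (b, i) ->
    exists2 r, rep i = Some r & arg r = Some (neg r, i).
  move=> ki; rewrite /rep; case: pickP => [r|/(_ k)]; last by rewrite ki eqxx.
  move=> ri; exists r => //; rewrite /neg; move: ri.
  by case: (arg r) => [[br l]|] //= /eqP[->].
pose KR := [set k | if arg k is Some (_, i) then rep i == Some k else false].
pose e k := if arg k is Some (b, i) then
  if rep i is Some r then Some (b (+) neg r, r) else None else None.
pose flip (a : option (bool * 'I_n)) := omap (fun bi => (~~ bi.1, bi.2)) a.
pose KZ := [set k | ~~ isSome (arg k)].
pose KD := [set kl : 'I_(ar j) * 'I_(ar j) | arg kl.1 == arg kl.2].
pose KS := [set kl : 'I_(ar j) * 'I_(ar j) | arg kl.2 == flip (arg kl.1)].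
pose iota k := if arg k is Some (_, i) then i else i0.
pose KN := [set k in KR | neg k].
have repR k b i r : arg k = Some (b, i) -> rep i = Some r -> r \in KR.
  by move=> /repP[r' rE ri]; rewrite rE => -[<-]; rewrite inE ri rE eqxx.
have elim_rep z k b i r : arg k = Some (b, i) -> rep i = Some r ->
    (elim_poly R e k).@[z] = (-1) ^+ b * ((-1) ^+ neg r * z r).
  by move=> ki ri; rewrite /elim_poly /e ki ri mevalZ mevalXU signr_addb mulrA.
have elim_none z k : arg k = None -> (elim_poly R e k).@[z] = 0.
  by move=> k0; rewrite /elim_poly /e k0 meval0.
have e_elim : elimination R KZ KD KS KR e.
  split=> [r|k b r|z].
  - rewrite inE /e /neg; case rE : (arg r) => [[b i]|] // /eqP ->.
    by rewrite rE addbb.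
  - rewrite /e; case kE : (arg k) => [[b' i]|] //.
    have [r' r'E _] := repP _ _ _ kE; rewrite r'E => -[_ <-].
    exact: (repR _ _ _ _ kE r'E).
  - split=> [[z0 zD zS] k|zE].
      case kE : (arg k) => [[b i]|]; last first.
        by rewrite elim_none // z0 // inE kE.
      have [r rE argr] := repP _ _ _ kE; rewrite (elim_rep _ _ _ _ _ kE rE).
      have [eq_b|neq_b] := eqVneq b (neg r).
        have := zD (k, r); rewrite inE kE argr eq_b eqxx.
        move=> /(_ isT) /subr0_eq /= ->.
        by rewrite mulrA -signr_addb addbb mul1r.
      have eq_b : neg r = ~~ b by case: b (neg r) neq_b {kE} => [] [].
      have := zS (k, r); rewrite inE kE argr eq_b eqxx => /(_ isT) /= /eqP.
      rewrite addr_eq0 => /eqP ->.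
      by rewrite mulrA -signr_addb; case: (b) => /=; rewrite expr1 mulN1r.
    pose g i := if rep i is Some r then (-1) ^+ neg r * z r else 0.
    have zg k : z k = argval g (arg k).
      rewrite zE; case kE : (arg k) => [[b i]|] /=; last by rewrite elim_none.
      have [r rE argr] := repP _ _ _ kE; rewrite (elim_rep _ _ _ _ _ kE rE).
      by rewrite /g rE.
    split=> [k|[k l]|[k l]]; rewrite inE /= ?zg.
    + by case: (arg k).
    + by move=> /eqP ->; rewrite subrr.
    + move=> /eqP ->; case: (arg k) => [[b i]|] /=; last by rewrite addr0.
      by rewrite signrN mulNr subrr.
have KN_sub : KN \subset KR :\: finset.set0.
  by rewrite finset.setD0; apply/fintype.subsetP => k; rewrite inE => /andP[].
have iota_inj : {in KR :\: finset.set0 &, injective iota}.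
  move=> k l; rewrite finset.setD0 !inE /iota.
  case: (arg k) => [[b i]|] //; case: (arg l) => [[b' i']|] //.
  by move=> /eqP ri /eqP ri' eq_i; move: ri'; rewrite -eq_i ri => -[].
rewrite [X in piece X](_ : _ = box_variety (q j) e finset.set0 KN iota).
  by apply: piece_box e_elim _ KN_sub iota_inj; apply: finset.sub0set.
pose Q := q j \mPo [tuple elim_poly R e k | k < ar j].
have boxE x : (coeff_in finset.set0 0%MM Q).@[
    fun k => (-1) ^+ (k \in KN) * x (iota k)] =
    (q j).@[fun k => argval x (arg k)].
  rewrite coeff_in0 comp_mpoly_meval; apply: meval_eq => k.
  rewrite tnth_mktuple; case kE : (arg k) => [[b i]|] /=; last by rewrite elim_none.
  have [r rE argr] := repP _ _ _ kE; rewrite (elim_rep _ _ _ _ _ kE rE) inE.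
  have rR := repR _ _ _ _ kE rE.
  rewrite inE rR /= /iota argr; congr (_ * _).
  by rewrite mulrA -signr_addb addbb mul1r.
apply/seteqP; split=> x /=.
  move=> qx0 alpha; have [->|alpha_neq0] := eqVneq alpha 0%MM; first by rewrite boxE.
  by rewrite coeff_in_set0 // meval0.
by move=> /(_ 0%MM); rewrite boxE.
Qed.

Lemma test_zero_set n (i0 : 'I_n) (t : test R ar n) : affine_op (test_op t) ->
  (forall x, test_val q t x = 0) \/ piece [set x | test_val q t x = 0]%classic.
Proof.
case: t => [[|||c|j] arg] //= _; rewrite /test_val /=.
- have tE (x : 'I_n -> R[i]) :
      ('X_ord0 + 'X_ord_max : {mpoly R[i][2]}).@[fun i => argval x (arg i)] =
      argval x (arg ord0) + argval x (arg ord_max) by rewrite mevalD !mevalXU.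
  under eq_set do rewrite tE; under eq_forall do rewrite tE.
  exact: two_args_zero_set.
- pose flip (a : option (bool * 'I_n)) := omap (fun bi => (~~ bi.1, bi.2)) a.
  have tE (x : 'I_n -> R[i]) :
      ('X_ord0 - 'X_ord_max : {mpoly R[i][2]}).@[fun i => argval x (arg i)] =
      argval x (arg ord0) + argval x (flip (arg ord_max)).
    rewrite mevalB !mevalXU; congr (_ + _).
    by case: (arg ord_max) => [[b i]|] /=; rewrite ?oppr0 // signrN mulNr.
  under eq_set do rewrite tE; under eq_forall do rewrite tE.
  exact: two_args_zero_set.
- have [->|c_neq0] := eqVneq c 0; first by left=> x; rewrite scale0r meval0.
  have tE (x : 'I_n -> R[i]) :
      ((c *: 'X_ord0 : {mpoly R[i][1]}).@[fun i => argval x (arg i)] = 0) =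
      (argval x (arg ord0) + argval x None = 0).
    rewrite mevalZ mevalXU addr0; apply/propext; split=> /eqP.
      by rewrite mulf_eq0 (negPf c_neq0) => /eqP.
    by move=> /eqP ->; rewrite mulr0.
  under eq_set do rewrite tE; under eq_forall do rewrite tE.
  exact: two_args_zero_set.
by right; apply: box_zero_set.
Qed.

End Pieces.

(** * Relative errors *)

Lemma relative_error_step (F : numDomainType) (e d theta : F) K :
  0 <= e -> `|d| <= e -> `|theta - 1| <= (1 + e) ^+ K - 1 ->
  `|(1 + d) * theta - 1| <= (1 + e) ^+ K.+1 - 1.
Proof.
move=> e_ge0 d_le theta_le.
have -> : (1 + d) * theta - 1 = (1 + d) * (theta - 1) + d by ring.
have -> : (1 + e) ^+ K.+1 - 1 = (1 + e) * ((1 + e) ^+ K - 1) + e.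
  by rewrite exprS; ring.
apply: le_trans (ler_normD _ _) _; rewrite lerD // normrM ler_pM //.
by apply: le_trans (ler_normD _ _) _; rewrite normr1 lerD2l.
Qed.

(** The stronger bound with 2 ^ K - 1 for 2 ^ K goes through the induction. *)
Lemma relative_error_bound (F : numDomainType) (e : F) K :
  0 <= e <= 1 -> (1 + e) ^+ K - 1 <= 2 ^+ K * e.
Proof.
move=> /andP[e_ge0 e_le1]; rewrite lerBlDl.
have {}IH : (1 + e) ^+ K <= 1 + (2 ^+ K - 1) * e.
  elim: K => [|K IHK]; first by rewrite !expr0 subrr mul0r addr0.
  rewrite exprS; apply: le_trans (_ : (1 + e) * (1 + (2 ^+ K - 1) * e) <= _).
    by rewrite ler_wpM2l ?addr_ge0.
  rewrite -subr_ge0 exprS.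
  have -> : 1 + (2 * 2 ^+ K - 1) * e - (1 + e) * (1 + (2 ^+ K - 1) * e) =
     (2 ^+ K - 1) * (e * (1 - e)) by ring.
  by rewrite !mulr_ge0 ?subr_ge0 ?exprn_ege1 ?ler1n.
apply: le_trans IH _; rewrite lerD2l ler_wpM2r //.
by rewrite gerBl.
Qed.

(** * Evaluable polynomials *)

Section Evaluability.
Variables (R : realType) (J : Type) (ar : J -> nat).
Variable q : forall j : J, {mpoly R[i][ar j]}.
Hypothesis q_affine : forall j, affine_mpoly (q j).
Variables (n : nat) (i0 : 'I_n) (p : {mpoly R[i][n]}).
Local Notation test := (test R ar).
Local Notation prog := (prog R ar).

Section Necessity.
Variable P : prog n.
Hypothesis P_accurate : accurate_on q [set: 'I_n -> R[i]]%classic p P.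

Lemma zeros_same_tests x y :
  all (same_zero q x y) (tests P) -> p.@[x] = 0 -> p.@[y] = 0.
Proof.
have half01 : 0 < (2^-1 : R) < 1 by rewrite invr_gt0 ltr0n invf_lt1 ?ltr1n ?ltr0n.
have [eps [/andP[eps_gt0 _] acc]] := P_accurate half01.
have epsC_gt0 : 0 < (eps%:C)%C by rewrite ltcR.
move=> /(generic_errors q_affine epsC_gt0)[delta delta_le eq_eval] px0.
have := acc x delta I delta_le.
rewrite px0 normr0 mulr0 subr0 normr_le0 eq_eval => /eqP ev_y.
have := acc y delta I delta_le; rewrite ev_y sub0r normrN.
apply: contraTeq => py_neq0; rewrite lt_geF // gtr_pMl ?normr_gt0 //.
by rewrite (ltcR _ 1); case/andP: half01.
Qed.

(** At the point x + s (y - x) of the line through x and y the same tests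
    vanish as at x, except for finitely many s. *)
Lemma zeros_test_closed x y :
  all (fun t => (test_val q t x == 0) ==> (test_val q t y == 0)) (tests P) ->
  p.@[x] = 0 -> p.@[y] = 0.
Proof.
move=> xy px0; pose u i := y i - x i.
have [g gE] := meval_line p x u.
pose slope (t : test n) := test_val q t u - test_val q t (fun=> 0).
suff g0 : g = 0.
  have := gE 1; rewrite g0 horner0 => ->; apply: meval_eq => i.
  by rewrite mul1r addrC subrK.
pose bad (t : test n) := - (test_val q t x / slope t).
apply: (@poly_eq0_outside _ _ (map bad (tests P))) => s s_good.
rewrite gE; apply: zeros_same_tests px0.
move/notin_map_all in s_good.
have : all (predI (predI (fun t => affine_op (test_op t))
    (fun t => (test_val q t x == 0) ==> (test_val q t y == 0)))
    (fun t => bad t != s)) (tests P).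
  by rewrite !all_predI tests_affine s_good andbT.
apply: sub_all => t /andP[/andP[/= t_affine txy] t_good].
have line r : test_val q t (fun i => x i + r * u i) = test_val q t x + r * slope t.
  exact: test_affine.
have yE : test_val q t y = test_val q t x + slope t.
  have := line 1; rewrite mul1r => <-; congr test_val.
  by apply/funext => i; rewrite mul1r addrC subrK.
rewrite /same_zero line; apply/eqP; case: eqP txy => [tx0|/eqP tx_neq0 _].
  by rewrite yE tx0 !add0r => /eqP ->; rewrite mulr0 eqxx.
apply/esym/negP; apply: contraNnot t_good.
rewrite addr_eq0 => /eqP txE; rewrite /bad txE mulNr opprK mulfK //.
by apply: contraNneq tx_neq0 => slope0; rewrite txE slope0 mulr0 oppr0.
Qed.

Lemma zeros_union_of_intersections : union_of_intersections q (zeros p).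
Proof.
pose T i := tnth (in_tuple (tests P)) i.
pose Z i := [set x | test_val q (T i) x = 0]%classic.
have T_affine i : affine_op (test_op (T i)).
  exact: (elimT (@all_tnthP _ _ _ (in_tuple (tests P))) (tests_affine P)).
pose G := [set A : {set 'I_(size (tests P))} |
  `[< (forall i, i \in A -> piece q (Z i)) /\
      forall x, (forall i, i \in A -> Z i x) -> p.@[x] = 0 >]].
exists #|G|, (fun a : 'I_#|G| => #|enum_val a|), (fun a b => Z (enum_val b)).
split=> [a b|].
  have := enum_valP a; rewrite inE => /asboolP[+ _]; apply.
  exact: enum_valP.
apply/seteqP; split=> x /=; last first.
  case=> a _ xa; have := enum_valP a; rewrite inE => /asboolP[_]; apply=> i ia.
  by have := xa (enum_rank_in ia i) I; rewrite enum_rankK_in.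
move=> px0; pose A := [set i | `[< piece q (Z i) /\ Z i x >]].
have AG : A \in G.
  rewrite inE; apply/asboolP; split=> [i|y Ay]; first by rewrite inE => /asboolP[].
  apply: zeros_test_closed px0.
  apply: (introT (@all_tnthP _ _ _ (in_tuple (tests P)))) => i; apply/implyP => /eqP txi.
  apply/eqP; have [Ti0|Zi] := test_zero_set q i0 (T_affine i); first exact: Ti0.
  by apply: Ay; rewrite inE; apply/asboolP.
exists (enum_rank_in AG A) => // b _.
have := enum_valP b; rewrite {2}enum_rankK_in // inE => /asboolP[_].
exact.
Qed.
End Necessity.

Section Sufficiency.

(** Multiplies the quantity acc by the values of the tests in ts at the inputs
    src, where z is a quantity equal to 0. *)
Fixpoint product_prog k (src : 'I_n -> 'I_k) (z acc : 'I_k) (ts : seq (test n)) :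
    prog k :=
  if ts is t :: ts' then
    @Compute R J ar k (test_op t)
      (fun i => if test_arg t i is Some (b, l) then (b, src l) else (false, z))
      (@Compute R J ar k.+1 (OpMul R J)
        (fun i => (false, if i == ord0 then lift ord_max acc else ord_max))
        (product_prog (fun l => lift ord_max (lift ord_max (src l)))
           (lift ord_max (lift ord_max z)) ord_max ts'))
  else @Output R J ar k acc.

Lemma extend_old T k (v : 'I_k -> T) y i : extend v y (lift ord_max i) = v i.
Proof. by rewrite /extend liftK. Qed.

Lemma extend_new T k (v : 'I_k -> T) y : extend v y ord_max = y.
Proof. by rewrite /extend unlift_none. Qed.

Lemma test_node_val k (v : 'I_k -> R[i]) (x : 'I_n -> R[i]) src z (t : test n) :
  v \o src =1 x -> v z = 0 ->
  (op_poly q (test_op t)).@[fun i =>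
    (-1) ^+ (if test_arg t i is Some (b, l) then (b, src l) else (false, z)).1 *
    v (if test_arg t i is Some (b, l) then (b, src l) else (false, z)).2] =
  test_val q t x.
Proof.
move=> srcE z0; apply: meval_eq => i; case: (test_arg t i) => [[b l]|] /=.
  by rewrite -srcE.
by rewrite z0 mulr0.
Qed.

Lemma eval_product_prog k (v : 'I_k -> R[i]) x src z acc ts e
    (delta : node (product_prog src z acc ts) -> R[i]) :
  v \o src =1 x -> v z = 0 -> 0 <= e -> (forall d, `|delta d| <= e) ->
  exists2 theta, eval q v delta = v acc * \prod_(t <- ts) test_val q t x * theta &
    `|theta - 1| <= (1 + e) ^+ (2 * size ts) - 1.
Proof.
elim: ts k v src z acc delta => [|t ts IHts] k v src z acc delta srcE z0 e_ge0 delta_le.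
  by exists 1; rewrite ?big_nil ?mulr1 // expr0 !subrr normr0.
rewrite [product_prog _ _ _ _]/= in delta delta_le *.
set v1 := extend v (test_val q t x * (1 + delta None)).
set v2 := extend v1
  (v acc * (test_val q t x * (1 + delta None)) * (1 + delta (Some None))).
have [||//||theta evalE theta_le] :=
  IHts _ v2 (fun l => lift ord_max (lift ord_max (src l)))
    (lift ord_max (lift ord_max z)) ord_max (fun d => delta (Some (Some d))).
- by move=> l; rewrite /= /v2 /v1 !extend_old; apply: srcE.
- by rewrite /v2 /v1 !extend_old.
- by move=> d; apply: delta_le.
exists ((1 + delta None) * ((1 + delta (Some None)) * theta)).
  have mulE : ('X_ord0 * 'X_ord_max : {mpoly R[i][2]}).@[fun i =>
      (-1) ^+ false * v1 (if i == ord0 then lift ord_max acc else ord_max)] =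
      v acc * (test_val q t x * (1 + delta None)).
    by rewrite mevalM !mevalXU /= !mul1r /v1 extend_old extend_new.
  have -> : eval q v delta = eval q v2 (fun d => delta (Some (Some d))).
    by rewrite /= (test_node_val t srcE z0) -/v1 mulE.
  rewrite evalE /v2 extend_new big_cons; ring.
by rewrite mulnS; do 2![apply: relative_error_step => //].
Qed.

Lemma product_evaluable c t0 ts :
  (forall x, p.@[x] = c * test_val q t0 x * \prod_(t <- ts) test_val q t x) ->
  accurately_evaluable q [set: 'I_n -> R[i]]%classic p.
Proof.
move=> pE.
pose l1 k (i : 'I_k) := lift ord_max i.
pose P := @Compute R J ar n (OpSub R J) (fun=> (false, i0))
  (@Compute R J ar n.+1 (test_op t0)
    (fun i => if test_arg t0 i is Some (b, l) then (b, l1 _ l)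
              else (false, ord_max))
    (@Compute R J ar n.+2 (OpScale J c) (fun=> (false, ord_max))
      (product_prog (fun l => l1 _ (l1 _ (l1 _ l))) (l1 _ (l1 _ ord_max))
         ord_max ts))).
have evalP x (e : R[i]) (delta : node P -> R[i]) :
    0 <= e -> (forall d, `|delta d| <= e) ->
    exists2 theta, eval q x delta = p.@[x] * theta &
      `|theta - 1| <= (1 + e) ^+ (2 * size ts).+2 - 1.
  move=> e_ge0 delta_le.
  set v1 := extend x 0; set v2 := extend v1 (test_val q t0 x * (1 + delta (Some None))).
  set v3 := extend v2
    (c * (test_val q t0 x * (1 + delta (Some None))) *
     (1 + delta (Some (Some None)))).
  have [||//||theta evalE theta_le] :=
    @eval_product_prog _ v3 x (fun l => l1 _ (l1 _ (l1 _ l)))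
      (l1 _ (l1 _ ord_max)) ord_max ts e (fun d => delta (Some (Some (Some d)))).
  - by move=> l; rewrite /= /l1 /v3 /v2 /v1 !extend_old.
  - by rewrite /l1 /v3 /v2 /v1 !extend_old extend_new.
  - by move=> d; apply: delta_le.
  exists ((1 + delta (Some None)) * ((1 + delta (Some (Some None))) * theta)).
    have -> : eval q x delta = eval q v3 (fun d => delta (Some (Some (Some d)))).
      rewrite /= mevalB !mevalXU subrr mul0r -/v1.
      rewrite (@test_node_val _ v1 x (l1 _)) -/v2 ?/v1 ?extend_new //; last first.
        by move=> l; rewrite /= extend_old.
      by rewrite mevalZ mevalXU /= mul1r [v2 ord_max]extend_new.
    rewrite evalE /v3 extend_new pE; ring.
  by do 2![apply: relative_error_step => //].
exists P; split=> [x|eta /andP[eta_gt0 eta_lt1]].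
  have [|theta -> ] := evalP x 0 (fun=> 0) (lexx _).
    by move=> _; rewrite normr0.
  rewrite addr0 expr1n subrr normr_le0 subr_eq0 => /eqP ->; exact: mulr1.
pose K := (2 * size ts).+2; exists (eta / 2 ^+ K).
have pow_ge1 : 1 <= 2 ^+ K :> R by rewrite exprn_ege1 ?ler1n.
have pow_gt0 : 0 < 2 ^+ K :> R by apply: lt_le_trans pow_ge1.
have eps_lt1 : eta / 2 ^+ K < 1.
  by rewrite ltr_pdivrMr // mul1r (lt_le_trans eta_lt1).
have eps_gt0 : 0 < eta / 2 ^+ K by rewrite divr_gt0.
split=> [|x delta _ delta_le]; first by rewrite eps_gt0.
have [|theta -> theta_le] := evalP x _ delta _ delta_le; first by rewrite lecR ltW.
rewrite -[X in _ - X]mulr1 -mulrBr normrM mulrC ler_wpM2r //.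
apply: le_trans theta_le _; apply: le_trans (relative_error_bound _ _) _.
  by rewrite lecR ltW //= (lecR _ 1) ltW.
rewrite -[2]/(1 + 1) -/K.
have -> : (2 ^+ K : R[i]) = ((2 ^+ K : R)%:C)%C.
  by rewrite rmorphXn rmorphD rmorph1.
by rewrite -rmorphM lecR mulrC divfK // gt_eqF.
Qed.

Definition test_poly (t : test n) : {mpoly R[i][n]} :=
  op_poly q (test_op t) \mPo [tuple
    if test_arg t i is Some (b, l) then (-1) ^+ b *: 'X_l else 0
    | i < op_arity ar (test_op t)].

Lemma test_polyE t x : (test_poly t).@[x] = test_val q t x.
Proof.
rewrite comp_mpoly_meval; apply: meval_eq => i; rewrite tnth_mktuple.
by case: (test_arg t i) => [[b l]|]; rewrite ?meval0 // mevalZ mevalXU.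
Qed.

(** Each nonempty intersection in the union misses a point where p is nonzero,
    so one of its members is not the whole space and gives a test that is not
    constant. For an empty intersection any such test will do. *)
Lemma union_evaluable :
  (msize p = 1%N -> exists j, (q j).@[fun=> 0] != 0) ->
  union_of_intersections q (zeros p) ->
  accurately_evaluable q [set: 'I_n -> R[i]]%classic p.
Proof.
move=> p_const [N [M [B [B_piece zeros_p]]]].
have [p0|p_neq0] := eqVneq p 0.
  apply: (@product_evaluable 0 (@var_test R J ar n i0) [::]) => x.
  by rewrite p0 meval0 !mul0r.
have pick a : exists t : test n, [/\ affine_op (test_op t),
    exists x y, test_val q t x != test_val q t y &
    forall x, (forall b, B a b x) -> test_val q t x = 0].
  have [[x0 Bx0]|/forallNP no_x] := pselect (exists x, forall b, B a b x); last first.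
    exists (@var_test R J ar n i0); split=> // [|x /no_x //].
    by exists (fun=> 0), (fun=> 1); rewrite !var_testE eq_sym oner_eq0.
  have [y py] := mpoly_nonzero_value p_neq0.
  have [b nBy] : exists b, ~ B a b y.
    apply/existsNP => By; case/eqP: py.
    by have : zeros p y by rewrite zeros_p; exists a.
  have [t [t_affine Bt t_full]] := piece_in_test q_affine (B_piece a b).
  exists t; split=> // [|x Bx]; last exact/Bt/Bx.
  have [x1 tx1] : exists x, test_val q t x <> 0.
    by apply/existsNP => t0; apply: nBy; apply: t_full (Bx0 b).
  by exists x1, x0; rewrite [X in _ != X]Bt //; apply/eqP.
have [tt ttP] := choice pick.
have [a x u s|a|//|x px|c [s pE]] :=
  @product_of_affine _ n 'I_N (fun a => test_poly (tt a)) p.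
- by rewrite !test_polyE; have [t_affine _ _] := ttP a; apply: test_affine.
- by have [_ [x [y xy]] _] := ttP a; exists x, y; rewrite !test_polyE.
- have : zeros p x by [].
  rewrite zeros_p => -[a _ Bx]; exists a; rewrite test_polyE.
  by have [_ _] := ttP a; apply=> b; apply: Bx.
case: s pE => [|a s] pE.
  move: pE; rewrite big_nil mulr1 => pE.
  have c_neq0 : c != 0 by apply: contraNneq p_neq0 => c0; rewrite pE c0.
  have [|j qj] := p_const; first by rewrite pE msizeC c_neq0.
  apply: (@product_evaluable (c / (q j).@[fun=> 0])
    (@Test R J ar n (OpBox R j) (fun=> None)) [::]) => x.
  by rewrite big_nil mulr1 pE mevalC divfK.
apply: (@product_evaluable c (tt a) (map tt s)) => x.
rewrite pE big_cons big_map !mevalM mevalC rmorph_prod /= test_polyE -mulrA.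
by congr (_ * (_ * _)); apply: eq_bigr => b _; rewrite test_polyE.
Qed.
End Sufficiency.
End Evaluability.

Theorem theorem5p28 (R : realType) (J : Type) (ar : J -> nat)
    (q : forall j : J, {mpoly R[i][ar j]})
    (q_irr : forall j, irreducible_mpoly (q j))
    (q_affine : forall j, affine_mpoly (q j))
    (n : nat) (n_gt0 : (0 < n)%N) (p : {mpoly R[i][n]})
    (p_const : msize p = 1%N -> exists j, (q j).@[fun=> 0] != 0) :
  accurately_evaluable q [set: 'I_n -> R[i]]%classic p <->
  union_of_intersections q (zeros p).
Proof.
split=> [[P [_ P_accurate]]|].
  exact: (zeros_union_of_intersections q_affine (Ordinal n_gt0) P_accurate).
exact: (union_evaluable q_affine (Ordinal n_gt0) p_const).
Qed.
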